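(* Let $A\in\mathbb{R}^{m\times n}$, $b\in\mathbb{R}^m$, $c\in\mathbb{R}^n$, $l\in\mathbb{R}^n$ with all entries positive, and let $r$ be an integer with $0<r\le n$. Consider $$(\mathcal{P})\qquad \min_{x\in\mathbb{R}^n}\ c^Tx\quad\text{s.t. } Ax=b,\ 0\le x\le l,\ \|x\|_0\le r,$$ $$(\hat{\mathcal{D}})\qquad \min_{y\in\mathbb{R}^m,\,z\in\mathbb{R}^n}\ -b^Ty+\left\|\Pi_{S(r)\cap\mathbb{R}^n_+}(l\circ z)\right\|_1\quad\text{s.t. } A^Ty-z=c.$$ Suppose $(y^*,z^* )$ is an optimal solution of $(\hat{\mathcal{D}})$, and let $\{t_1,\ldots,t_n\}$ be a permutation of $\{1,\ldots,n\}$ such that $l_{t_1}z^*_{t_1}\ge l_{t_2}z^*_{t_2}\ge\cdots\ge l_{t_n}z^*_{t_n}$. Then: (i) $0$ is an optimal solution of $(\mathcal{P})$ if $z^*<0$ (entrywise); (ii) $\{t_1,\ldots,t_r\}$ is an optimal index set of $(\mathcal{P})$ if one of the following holds: (a) $\|[z^*]_+\|_0=r$; (b) $\|[z^*]_+\|_0>r$ and $l_{t_r}z^*_{t_r}>l_{t_{r+1}}z^*_{t_{r+1}}$; (c) $0<\|[z^*]_+\|_0<r$ and $z^*_{t_{r+1}}<0$.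
   Context: The feasible region of $(\mathcal{P})$ is assumed nonempty. Conditions that mention the index $t_{r+1}$ presuppose $r<n$. Notation: $\|x\|_0$ is the number of nonzero entries of $x$; inequalities between vectors are entrywise; $[z]_+=\max\{z,0\}$ entrywise; $\mathbb{R}^n_+$ is the set of entrywise nonnegative vectors; $S(r)=\{x\in\mathbb{R}^n:\|x\|_0\le r\}$; $\circ$ is the entrywise (Hadamard) product; $\|\cdot\|_1$ is the $\ell_1$ norm. For a closed set $\Omega\subseteq\mathbb{R}^n$, $\Pi_\Omega(z)=\arg\min_{y\in\Omega}\|z-y\|^2$ (Euclidean norm), possibly set-valued. All elements of $\Pi_{S(r)\cap\mathbb{R}^n_+}(z)$ have the same $\ell_1$ norm, and $\|\Pi_{S(r)\cap\mathbb{R}^n_+}(z)\|_1$ denotes this common value; it equals the sum of the $r$ largest entries of $[z]_+$. Let $\mathcal{J}(r)$ be the set of subsets of $\{1,\ldots,n\}$ of cardinality $r$, and for an index set $I$ let $\mathbb{R}^n_I$ be the subspace of $\mathbb{R}^n$ spanned by the standard basis vectors $e_i$, $i\in I$. An index set $I^*\in\mathcal{J}(r)$ is an optimal index set of $(\mathcal{P})$ if there exists an optimal solution $x^*$ of $(\mathcal{P})$ with $x^*\in\mathbb{R}^n_{I^*}$. *)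

(* Defs.v *)
From HB Require Import structures.
From mathcomp Require Import all_boot all_order all_fingroup all_algebra.
From mathcomp Require Import boolp classical_sets reals.

Set Implicit Arguments.
Unset Strict Implicit.
Unset Printing Implicit Defensive.

Import Order.TTheory GRing.Theory Num.Theory.
Local Open Scope ring_scope.

Section Vectors.
Context {R : realType}.

Definition minimizers {T : Type} (D : set T) (f : T -> R) : set T :=
  fun x => D x /\ forall y, D y -> f x <= f y.

Definition dotv {n : nat} (u v : 'cV[R]_n) : R := (u^T *m v) 0 0.

Definition vle {n : nat} (u v : 'cV[R]_n) : Prop :=
  forall i, u i 0 <= v i 0.

Definition vlt {n : nat} (u v : 'cV[R]_n) : Prop :=
  forall i, u i 0 < v i 0.

Definition norm0 {n : nat} (x : 'cV[R]_n) : nat :=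
  #|[pred i | x i 0 != 0]|.

Definition norm1 {n : nat} (x : 'cV[R]_n) : R := \sum_i `|x i 0|.

Definition pospart {n : nat} (z : 'cV[R]_n) : 'cV[R]_n :=
  map_mx (fun a => Num.max a 0) z.

Definition hadamard {n : nat} (u v : 'cV[R]_n) : 'cV[R]_n :=
  map2_mx *%R u v.

Definition sparse {n : nat} (r : nat) : set 'cV[R]_n :=
  fun x => (norm0 x <= r)%N.

Definition nonneg {n : nat} : set 'cV[R]_n := fun x => vle 0 x.

(* dotv (z - y) (z - y) is the squared Euclidean norm of z - y. *)
Definition proj {n : nat} (Omega : set 'cV[R]_n) (z : 'cV[R]_n) :
    set 'cV[R]_n :=
  minimizers Omega (fun y => dotv (z - y) (z - y)).

(* The l1 norm of the set-valued projection onto S(r) and the nonnegative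
   orthant: all its elements have the same l1 norm, so it is read off an
   arbitrary one. The projection is never empty, so the default value 0 of
   xget plays no role. *)
Definition norm1_proj {n : nat} (r : nat) (z : 'cV[R]_n) : R :=
  norm1 (xget 0 (proj (setI (sparse r) nonneg) z)).

Definition coord_space {n : nat} (I : {set 'I_n}) : {vspace 'cV[R]_n} :=
  <<[seq (delta_mx i 0)%R | i <- enum I]>>%VS.

End Vectors.

Section Problems.
Context {R : realType} {m n : nat}.
Variables (A : 'M[R]_(m, n)) (b : 'cV[R]_m) (c l : 'cV[R]_n) (r : nat).

Definition primal_feasible : set 'cV[R]_n :=
  fun x => [/\ A *m x = b, vle 0 x, vle x l & (norm0 x <= r)%N].

Definition primal_optimal : set 'cV[R]_n :=
  minimizers primal_feasible (dotv c).

Definition dual_feasible : set ('cV[R]_m * 'cV[R]_n) :=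
  fun yz => A^T *m yz.1 - yz.2 = c.

Definition dual_objective (yz : 'cV[R]_m * 'cV[R]_n) : R :=
  - dotv b yz.1 + norm1_proj r (hadamard l yz.2).

Definition dual_optimal : set ('cV[R]_m * 'cV[R]_n) :=
  minimizers dual_feasible dual_objective.

Definition optimal_index_set (I : {set 'I_n}) : Prop :=
  #|I| = r /\ exists x, primal_optimal x /\ x \in coord_space I.

End Problems.

(* {t_1, ..., t_r}; indices start at 0, so t_(k+1) is t applied to k. *)
Definition first_indices {n : nat} (t : {perm 'I_n}) (r : nat) : {set 'I_n} :=
  (t @: [set i : 'I_n | (i < r)%N])%SET.

(* Main.v *)
Require Import Defs.
From HB Require Import structures.
From mathcomp Require Import all_boot all_order all_fingroup all_algebra.
From mathcomp Require Import boolp classical_sets reals.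
From mathcomp Require Import ring lra.

Set Implicit Arguments.
Unset Strict Implicit.
Unset Printing Implicit Defensive.

Import Order.TTheory GRing.Theory Num.Theory.
Local Open Scope ring_scope.

(* Let T be the set of the first r indices. Under each of the conditions, a
   threshold theta >= 0 separates the entries of [l o z]_+ on T from those off
   T, and keeps separating them when z is perturbed slightly around zstar. So
   near (ystar, zstar) the dual objective equals
     - b^T y + \sum_(i in T) l_i [z_i]_+,
   a sum of one-variable convex functions of z. Optimality makes its
   directional derivatives nonnegative: b^T d is bounded by the support function
   of the zonotope \sum_i [lo_i, up_i] a_i, where a_i is the i-th column of A and
   [lo_i, up_i] is the subdifferential of l_i [.]_+ at zstar_i (and {0} off T).
   Hahn-Banach, one segment at a time, then gives b = A x with
   lo <= x <= up; this x is supported in T, is feasible, and attains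
   zstar^T x = \sum_(i in T) l_i [zstar_i]_+, the maximum of zstar^T x over the
   primal feasible points, so x is optimal. *)

(** * Bilinearity of the dot product *)

Section DotProduct.
Context {R : realType} {n : nat}.
Implicit Types u v w : 'cV[R]_n.

Lemma dotvE u v : dotv u v = \sum_i u i 0 * v i 0.
Proof. by rewrite /dotv mxE; apply: eq_bigr => i _; rewrite mxE. Qed.

Lemma dotvC u v : dotv u v = dotv v u.
Proof. by rewrite !dotvE; apply: eq_bigr => i _; rewrite mulrC. Qed.

Lemma dotvDr u v w : dotv u (v + w) = dotv u v + dotv u w.
Proof. by rewrite /dotv mulmxDr mxE. Qed.

Lemma dotvZr k u v : dotv u (k *: v) = k * dotv u v.
Proof. by rewrite /dotv -scalemxAr mxE. Qed.

Lemma dotvBl u v w : dotv (u - v) w = dotv u w - dotv v w.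
Proof. by rewrite !(dotvC _ w) -scaleN1r dotvDr dotvZr mulN1r. Qed.

Lemma dotvZl k u v : dotv (k *: u) v = k * dotv u v.
Proof. by rewrite !(dotvC _ v) dotvZr. Qed.

End DotProduct.

Lemma dotv_trmx {R : realType} {m n : nat} (A : 'M[R]_(m, n))
    (y : 'cV[R]_m) (x : 'cV[R]_n) :
  dotv (A^T *m y) x = dotv (A *m x) y.
Proof. by rewrite [RHS]dotvC /dotv trmx_mul trmxK mulmxA. Qed.

(** * Membership in a sum of segments by separation *)

Section SegmentSums.
Context {R : realType} {m : nat}.
Implicit Types (a b d : 'cV[R]_m) (lo up : R).

(* One step of the Hahn-Banach argument: [t] is the supremum of the lower
   bounds that the directions [d] with [dotv a d = 1] impose. *)
Lemma sublinear_split (p : 'cV[R]_m -> R) a b lo up :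
    (forall d e, p (d + e) <= p d + p e) ->
    (forall k d, 0 < k -> p (k *: d) = k * p d) ->
    lo <= up ->
    (forall d, dotv b d <=
       Num.max (lo * dotv a d) (up * dotv a d) + p d) ->
  exists2 t, lo <= t <= up & forall d, dotv b d - t * dotv a d <= p d.
Proof.
move=> pD pZ loup bp.
pose S : set R := fun s => s = lo \/
  exists2 d, dotv a d = 1 & s = dotv b d - p d.
have Slo : S lo by left.
have S0 : (S !=set0)%classic by exists lo.
have Sup : ubound S up.
  move=> s [->//|[d ad ->]].
  by have := bp d; rewrite ad !mulr1 (max_idPr loup); lra.
(* Directions with [dotv a e = -1] impose upper bounds on [t]. They are compatible with the lower
   bounds because [dotv a (d + e) = 0] and [p] is subadditive. *)
have Sneg e : dotv a e = -1 -> ubound S (p e - dotv b e).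
  move=> ae s [->|[d ad ->]].
    have := bp e; rewrite ae !mulrN1 (max_idPl _) ?lerN2//; lra.
  have := bp (d + e); have := pD d e.
  by rewrite !dotvDr ad ae subrr !mulr0 maxxx; lra.
have hS : has_ubound S by exists up.
exists (sup S); first by rewrite (ub_le_sup hS Slo) ge_sup.
(* Positive homogeneity rescales [d] so that [dotv a d] is -1 or 1, unless it is 0. *)
move=> d; have [ad|ad|ad] := ltgtP (dotv a d) 0.
- have ne : dotv a d != 0 by rewrite lt_eqF.
  have k0 : 0 < - (dotv a d)^-1 by rewrite oppr_gt0 invr_lt0.
  have : sup S <= p (- (dotv a d)^-1 *: d) - dotv b (- (dotv a d)^-1 *: d).
    by apply: ge_sup => //; apply: Sneg; rewrite dotvZr mulNr mulVf.
  by rewrite pZ // dotvZr -mulrBr mulNr mulrC -mulNr ler_ndivlMr//; lra.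
- have ne : dotv a d != 0 by rewrite gt_eqF.
  have k0 : 0 < (dotv a d)^-1 by rewrite invr_gt0.
  have : dotv b ((dotv a d)^-1 *: d) - p ((dotv a d)^-1 *: d) <= sup S.
    apply: (ub_le_sup hS); right; exists ((dotv a d)^-1 *: d) => //.
    by rewrite dotvZr mulVf.
  by rewrite pZ // dotvZr -mulrBr mulrC ler_pdivrMr//; lra.
- by have := bp d; rewrite ad !mulr0 maxxx; lra.
Qed.

(** For [lo i <= up i], the support function of the Minkowski sum of the segments from [lo i *: a i]
    to [up i *: a i]. *)
Definition segment_support n (a : 'I_n -> 'cV[R]_m) (lo up : 'I_n -> R) d : R :=
  \sum_i Num.max (lo i * dotv (a i) d) (up i * dotv (a i) d).

Lemma segment_supportD n (a : 'I_n -> 'cV[R]_m) (lo up : 'I_n -> R) d e :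
  segment_support a lo up (d + e) <=
    segment_support a lo up d + segment_support a lo up e.
Proof.
rewrite -big_split; apply: ler_sum => i _ /=.
rewrite !dotvDr !mulrDr ge_max; apply/andP; split;
  by apply: lerD; rewrite le_max lexx ?orbT.
Qed.

Lemma segment_supportZ n (a : 'I_n -> 'cV[R]_m) (lo up : 'I_n -> R) k d :
  0 < k -> segment_support a lo up (k *: d) = k * segment_support a lo up d.
Proof.
move=> k0; rewrite mulr_sumr; apply: eq_bigr => i _.
by rewrite !dotvZr maxr_pMr ?ltW// !(mulrCA k).
Qed.

(** Induction on the number of segments: [sublinear_split] fixes the coefficient of the first one,
    with the support function of the others as [p]. *)
Lemma segment_sumP n (a : 'I_n -> 'cV[R]_m) (lo up : 'I_n -> R) b :
    (forall i, lo i <= up i) ->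
    (forall d, dotv b d <= segment_support a lo up d) ->
  exists2 x : 'I_n -> R, forall i, lo i <= x i <= up i &
    b = \sum_i x i *: a i.
Proof.
elim: n a lo up b => [|n IH] a lo up b loup hb.
  exists (fun=> 0) => [[]//|]; rewrite big_ord0.
  (* With no segment left, the direction [d = b] gives a nonpositive squared norm, so [b = 0]. *)
  have := hb b; rewrite /segment_support big_ord0 dotvE => b_le0.
  have /psumr_eq0P b0 : \sum_i b i 0 * b i 0 = 0.
    by apply/le_anti; rewrite b_le0 sumr_ge0// => i _; rewrite -expr2 sqr_ge0.
  apply/colP => i; rewrite mxE; apply/eqP.
  rewrite -sqrf_eq0 expr2 b0// => j _; by rewrite -expr2 sqr_ge0.
have [] := @sublinear_split
  (segment_support (a \o lift ord0) (lo \o lift ord0) (up \o lift ord0))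
  (a ord0) b (lo ord0) (up ord0).
- exact: segment_supportD.
- exact: segment_supportZ.
- exact: loup.
- by move=> d; apply: le_trans (hb d) _; rewrite /segment_support big_ord_recl.
move=> t ht hd.
have [||x hx Ex] := IH (a \o lift ord0) (lo \o lift ord0) (up \o lift ord0)
  (b - t *: a ord0).
- by move=> i; apply: loup.
- by move=> d; rewrite dotvBl dotvZl.
exists (fun i => if unlift ord0 i is Some j then x j else t) => [i|].
  by case: unliftP => [j ->|->]//; apply: hx.
rewrite big_ord_recl unlift_none -[LHS](subrK (t *: a ord0)) Ex addrC.
by congr (_ + _); apply: eq_bigr => i _; rewrite liftK.
Qed.

End SegmentSums.

(** * Sums over the largest entries *)

Section TopSums.
Context {R : realType} {n : nat}.
Implicit Types (J T : {set 'I_n}) (v g : 'I_n -> R) (theta c : R).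

(** The constant [c] is free; taking a threshold for it gives every term of the sum a sign. *)
Lemma sum_set_diff J T g c :
  \sum_(i in T) g i - \sum_(i in J) g i =
    \sum_i ((i \in T)%:R - (i \in J)%:R) * (g i - c) +
    (#|T|%:R - #|J|%:R) * c.
Proof.
have sumE (K : {set 'I_n}) h : \sum_(i in K) h i = \sum_i (i \in K)%:R * h i.
  by rewrite big_mkcond; apply: eq_bigr => i _; case: ifP; rewrite ?mul1r ?mul0r.
have cardE (K : {set 'I_n}) : #|K|%:R * c = \sum_i (i \in K)%:R * c.
  by rewrite -sumE sumr_const mulr_natl.
rewrite mulrBl !cardE !sumE -!sumrB -big_split; apply: eq_bigr => i _ /=.
by ring.
Qed.

(** A certificate that [T] carries the largest entries; ties at [theta] may fall on either side. *)
Definition threshold T v theta :=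
  forall i, if i \in T then theta <= v i else v i <= theta.

Lemma threshold_diff J T v theta i : threshold T v theta ->
  0 <= ((i \in T)%:R - (i \in J)%:R) * (v i - theta).
Proof.
move=> /(_ i); case: (i \in T); case: (i \in J);
  rewrite ?subrr ?mul0r ?subr0 ?mul1r ?sub0r ?mulN1r //; lra.
Qed.

Lemma threshold_sum_le J T v theta :
    threshold T v theta -> 0 <= theta -> (#|J| <= #|T|)%N ->
  \sum_(i in J) v i <= \sum_(i in T) v i.
Proof.
move=> hT theta0 JT; rewrite -subr_ge0 (sum_set_diff _ _ _ theta).
rewrite addr_ge0 ?mulr_ge0 ?subr_ge0 ?ler_nat//.
by rewrite sumr_ge0// => i _; apply: threshold_diff.
Qed.

Lemma threshold_sqr T v theta :
    threshold T v theta -> 0 <= theta -> (forall i, 0 <= v i) ->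
  threshold T (fun i => v i ^+ 2) (theta ^+ 2).
Proof.
move=> hT theta0 v0 i; have := hT i.
by case: (i \in T) => ?; rewrite ler_pXn2r// nnegrE v0.
Qed.

(** Projections compare sums of squares, while the objective sums the entries themselves. Equality
    for squares kills every nonnegative term of [sum_set_diff] at [theta ^+ 2]; factoring the
    difference of squares kills the terms at [theta] too. *)
Lemma threshold_sum_eq J T v theta :
    threshold T v theta -> 0 <= theta -> (forall i, 0 <= v i) ->
    (#|J| <= #|T|)%N ->
    \sum_(i in T) v i ^+ 2 <= \sum_(i in J) v i ^+ 2 ->
  \sum_(i in J) v i = \sum_(i in T) v i.
Proof.
move=> hT theta0 v0 JT; rewrite -subr_le0 (sum_set_diff _ _ _ (theta ^+ 2)).
pose d i : R := (i \in T)%:R - (i \in J)%:R.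
have hi i : 0 <= d i * (v i ^+ 2 - theta ^+ 2).
  exact: threshold_diff (threshold_sqr hT theta0 v0).
have hc : 0 <= (#|T|%:R - #|J|%:R) * theta ^+ 2 :> R.
  by rewrite mulr_ge0 ?sqr_ge0 ?subr_ge0 ?ler_nat.
move=> le0; have sum0 : 0 <= \sum_i d i * (v i ^+ 2 - theta ^+ 2) by apply: sumr_ge0.
have /psumr_eq0P s0 : \sum_i d i * (v i ^+ 2 - theta ^+ 2) = 0 by lra.
have c0 : (#|T|%:R - #|J|%:R) * theta = 0 :> R.
  have /eqP : (#|T|%:R - #|J|%:R) * theta ^+ 2 = 0 :> R by lra.
  by rewrite expr2 mulrA mulf_eq0 => /orP[/eqP//|/eqP ->]; rewrite mulr0.
apply/esym/eqP; rewrite -subr_eq0 (sum_set_diff _ _ _ theta) c0 addr0.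
apply/eqP/big1 => i _; have /eqP := s0 (fun i _ => hi i) i isT.
rewrite subr_sqr !mulrA mulf_eq0 => /orP[/eqP//|].
by rewrite paddr_eq0// => /andP[/eqP -> /eqP ->]; rewrite subrr mulr0.
Qed.

End TopSums.

(** * The projection onto sparse nonnegative vectors *)

Section Projection.
Context {R : realType} {n : nat}.
Implicit Types (w p : 'cV[R]_n) (J T : {set 'I_n}).

Definition support p : {set 'I_n} := [set i | p i 0 != 0].

Lemma norm0E p : norm0 p = #|support p|.
Proof. by rewrite cardsE. Qed.

Lemma supportPn p i : i \notin support p -> p i 0 = 0.
Proof. by rewrite inE negbK => /eqP. Qed.

Lemma norm0_le_card p T : (forall i, i \notin T -> p i 0 = 0) ->
  (norm0 p <= #|T|)%N.
Proof.
move=> pT; rewrite norm0E; apply/subset_leq_card/fintype.subsetP => i.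
by rewrite inE; apply: contraR => /pT ->.
Qed.

Lemma in_coord_space p T : (forall i, i \notin T -> p i 0 = 0) ->
  p \in coord_space T.
Proof.
move=> pT; rewrite [p]matrix_sum_delta; apply: memv_suml => i _.
rewrite big_ord1; have [iT|/pT ->] := boolP (i \in T); last first.
  by rewrite scale0r mem0v.
by apply/memvZ/memv_span/map_f; rewrite mem_enum.
Qed.

(** Entrywise, [p i 0 * w i 0] is at most [p i 0] times the positive part of [w i 0]; completing the
    square does the rest. The last sum measures how far [p] is from that positive part on its
    support. *)
Lemma sqdist_ge w p : vle 0 p ->
  \sum_i w i 0 ^+ 2 - \sum_(i in support p) Num.max (w i 0) 0 ^+ 2 +
    \sum_(i in support p) (p i 0 - Num.max (w i 0) 0) ^+ 2
  <= dotv (w - p) (w - p).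
Proof.
move=> p0; rewrite dotvE -addrA -sumrN -big_split.
rewrite [X in _ + X]big_mkcond -big_split.
apply: ler_sum => i _ /=; rewrite !mxE; case: ifPn => [_|/supportPn ->].
  have := p0 i; rewrite mxE => pi0.
  have : p i 0 * w i 0 <= p i 0 * Num.max (w i 0) 0.
    by rewrite ler_wpM2l// le_max lexx.
  by nra.
by rewrite subr0 addr0 expr2.
Qed.

Definition truncation T w : 'cV[R]_n :=
  \col_i (if i \in T then Num.max (w i 0) 0 else 0).

Lemma sqdist_truncation T w :
  dotv (w - truncation T w) (w - truncation T w) =
  \sum_i w i 0 ^+ 2 - \sum_(i in T) Num.max (w i 0) 0 ^+ 2.
Proof.
rewrite dotvE [X in _ = _ - X]big_mkcond -sumrB; apply: eq_bigr => i _ /=.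
rewrite !mxE; case: ifP => _; last by ring.
by case: (leP (w i 0) 0) => _; ring.
Qed.

(** [truncation T w] attains the least distance. Any other projection must equal the positive part
    of [w] on its support, with the same sum of squares, hence the same sum by
    [threshold_sum_eq]. *)
Lemma norm1_projE r T w theta :
    #|T| = r -> 0 <= theta ->
    threshold T (fun i => Num.max (w i 0) 0) theta ->
  norm1_proj r w = \sum_(i in T) Num.max (w i 0) 0.
Proof.
move=> Tr theta0 hT.
have v0 i : 0 <= Num.max (w i 0) 0 by rewrite le_max lexx orbT.
have xF : setI (sparse r) nonneg (truncation T w).
  split; first by rewrite /sparse -Tr norm0_le_card// => i; rewrite mxE => /negPf->.
  by move=> i; rewrite !mxE; case: ifP.
have sq_le p : (norm0 p <= r)%N ->
    \sum_(i in support p) Num.max (w i 0) 0 ^+ 2 <=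
    \sum_(i in T) Num.max (w i 0) 0 ^+ 2.
  rewrite norm0E -Tr => pT; apply: threshold_sum_le pT; last exact: sqr_ge0.
  exact: threshold_sqr.
have x_proj : proj (setI (sparse r) nonneg) w (truncation T w).
  split=> // p [pr /(sqdist_ge w)]; rewrite sqdist_truncation.
  have := sq_le p pr.
  have : 0 <= \sum_(i in support p) (p i 0 - Num.max (w i 0) 0) ^+ 2.
    by apply: sumr_ge0 => i _; rewrite sqr_ge0.
  lra.
(* The truncation shows that the projection is nonempty, so [xget] returns some projection [p]. *)
rewrite /norm1_proj; case: xgetP => [p _|/(_ (truncation T w))//].
move=> [[pr p0] /(_ _ xF)]; rewrite sqdist_truncation.
have := sqdist_ge w p0; have := sq_le p pr.
have h0 i : 0 <= (p i 0 - Num.max (w i 0) 0) ^+ 2 by rewrite sqr_ge0.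
have : 0 <= \sum_(i in support p) (p i 0 - Num.max (w i 0) 0) ^+ 2.
  exact: sumr_ge0.
move=> h1 h2 h3 h4.
have /psumr_eq0P pv : \sum_(i in support p) (p i 0 - Num.max (w i 0) 0) ^+ 2 = 0.
  by lra.
rewrite -(threshold_sum_eq (J := support p) hT theta0 v0); last 2 first.
- by rewrite Tr -norm0E.
- by lra.
rewrite [RHS]big_mkcond; apply: eq_bigr => i _.
have := p0 i; rewrite mxE => /ger0_norm ->.
case: ifPn => [ip|/supportPn//].
have /eqP := pv (fun i _ => h0 i) i ip.
by rewrite sqrf_eq0 subr_eq0 => /eqP.
Qed.

End Projection.

(** * Small perturbations of positive parts *)

Section Perturbation.
Context {R : realType}.
Implicit Types (a q k z u l theta : R).

Lemma uniform_pos (I : finType) (P : I -> R -> Prop) :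
    (forall i, exists2 e, 0 < e & forall k, 0 < k <= e -> P i k) ->
  exists2 k, 0 < k & forall i, P i k.
Proof.
move=> hP; have /choice[e he] i :
    exists e, 0 < e /\ forall k, 0 < k <= e -> P i k.
  by have [e] := hP i; exists e.
(* The seed 1 keeps the minimum positive even when [I] is empty. *)
have e0 : 0 < \big[Num.min/1]_i e i.
  by apply: lt_bigmin => // i _; have [] := he i.
exists (\big[Num.min/1]_i e i) => // i; apply: (he i).2.
by rewrite e0 bigmin_le.
Qed.

Lemma lt_perturb a q c : a < c ->
  exists2 e, 0 < e & forall k, 0 < k <= e -> a + k * q < c.
Proof.
move=> ac; have q1 : 0 < 1 + `|q| by rewrite ltr_pwDl.
(* The added 1 avoids a zero denominator and makes the final inequality strict. *)
exists ((c - a) / (1 + `|q|)); first by rewrite divr_gt0 ?subr_gt0.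
move=> k /andP[k0]; rewrite ler_pdivlMr// => hk.
have : k * q <= k * `|q| by rewrite (ler_wpM2l (ltW k0)) ?ler_norm.
lra.
Qed.

(** For [l > 0], the endpoints of the subdifferential of the positive part of [l * z] as a function
    of [z]; the flag [s] stands for membership in [T], and both are 0 without it. *)
Definition lower_slope (s : bool) l z : R := if s && (0 < z) then l else 0.
Definition upper_slope (s : bool) l z : R := if s && (0 <= z) then l else 0.

(** Strict inequalities survive small moves; for [theta = 0] inside [T], positive parts are at least
    0 anyway. *)
Lemma threshold_perturb (s : bool) l z u theta : 0 <= theta ->
    (if s then theta = 0 \/ theta < l * z else l * z < theta \/
       theta = 0 /\ l * z < 0) ->
  exists2 e, 0 < e & forall k, 0 < k <= e ->
    if s then theta <= Num.max (l * (z + k * u)) 0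
    else Num.max (l * (z + k * u)) 0 <= theta.
Proof.
have dist k : l * (z + k * u) = l * z + k * (l * u) by ring.
move=> theta0; case: s => [[->|]|[|[-> ]]].
- by exists 1 => // k _; rewrite le_max lexx orbT.
- rewrite -ltrN2 => /(lt_perturb (- (l * u)))[e e0 he].
  exists e => // k /he; rewrite dist le_max mulrN; lra.
- move=> /(lt_perturb (l * u))[e e0 he].
  by exists e => // k /he; rewrite dist ge_max theta0 andbT => /ltW.
- move=> /(lt_perturb (l * u))[e e0 he].
  by exists e => // k /he; rewrite dist ge_max lexx andbT => /ltW.
Qed.

(** If [z] is nonzero, a small move keeps its sign and the positive part is linear there; at [z = 0]
    it is positively homogeneous. *)
Lemma slope_perturb l z u : 0 < l ->
  exists2 e, 0 < e & forall k, 0 < k <= e ->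
    Num.max (l * (z + k * u)) 0 - Num.max (l * z) 0 <=
      k * Num.max (lower_slope true l z * u) (upper_slope true l z * u).
Proof.
have dist k : l * (z + k * u) = l * z + k * (l * u) by ring.
move=> l0; rewrite /lower_slope /upper_slope /=; case: ltgtP => [z0|z0|<-].
- have : - (l * z) < 0 by rewrite oppr_lt0 mulr_gt0.
  move=> /(lt_perturb (- (l * u)))[e e0 he].
  exists e => // k /he; rewrite dist maxxx mulrN => h.
  have /max_idPl -> : 0 <= l * z + k * (l * u) by lra.
  have /max_idPl -> : 0 <= l * z by rewrite mulr_ge0 ?ltW.
  lra.
- have lz : l * z < 0 by rewrite pmulr_rlt0.
  have [e e0 he] := lt_perturb (l * u) lz.
  exists e => // k /he; rewrite dist => /ltW/max_idPr ->.
  by rewrite (max_idPr (ltW lz)) !mul0r maxxx mulr0 subrr.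
- exists 1 => // k /andP[k0 _].
  rewrite mulr0 add0r maxxx subr0 mul0r (maxr_pMr _ _ (ltW k0)) mulr0 maxC.
  by rewrite mulrCA.
Qed.

End Perturbation.

(** * From a dual optimum with a threshold to a primal optimum *)

Section Certificate.
Context {R : realType} {m n : nat}.
Variables (A : 'M[R]_(m, n)) (b : 'cV[R]_m) (c l : 'cV[R]_n) (r : nat).
Variables (y : 'cV[R]_m) (z : 'cV[R]_n) (T : {set 'I_n}) (theta : R).
Hypotheses (hl : vlt 0 l) (hopt : dual_optimal A b c l r (y, z)).
Hypotheses (Tr : #|T| = r) (theta0 : 0 <= theta).
Hypothesis hT : forall i, if i \in T then theta = 0 \/ theta < l i 0 * z i 0
  else l i 0 * z i 0 < theta \/ theta = 0 /\ l i 0 * z i 0 < 0.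

Let l0 i : 0 < l i 0. Proof. by have := hl i; rewrite mxE. Qed.

Let lo i := lower_slope (i \in T) (l i 0) (z i 0).
Let up i := upper_slope (i \in T) (l i 0) (z i 0).
Let v i := Num.max (l i 0 * z i 0) 0.

Lemma threshold_positive_parts : threshold T v theta.
Proof.
move=> i; rewrite /v le_max ge_max theta0 andbT; have := hT i.
by case: ifP => _ [|]; lra.
Qed.

Lemma dual_directional_bound d :
  dotv b d <= segment_support (fun i => col i A) lo up d.
Proof.
(* When [y] moves along [d], moving [z] along [u] preserves dual feasibility. *)
have [u uE] : exists u, u = A^T *m d by eexists.
have au i : dotv (col i A) d = u i 0.
  by rewrite dotvE uE mxE; apply: eq_bigr => j _; rewrite !mxE.
(* A single step [k] for all coordinates: [T] still carries the largest positive parts, so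
   [norm1_projE] applies at both points, and each increment is bounded by a one-sided slope. *)
have [k k0 hk] : exists2 k : R, 0 < k & forall i,
    (if i \in T then theta <= Num.max (l i 0 * (z i 0 + k * u i 0)) 0
     else Num.max (l i 0 * (z i 0 + k * u i 0)) 0 <= theta) /\
    Num.max (l i 0 * (z i 0 + k * u i 0)) 0 - v i <=
      k * Num.max (lower_slope true (l i 0) (z i 0) * u i 0)
                  (upper_slope true (l i 0) (z i 0) * u i 0).
  apply: uniform_pos => i.
  have [e1 e10 h1] := threshold_perturb (u i 0) theta0 (hT i).
  have [e2 e20 h2] := slope_perturb (z i 0) (u i 0) (l0 i).
  exists (Num.min e1 e2) => [|k]; first by rewrite lt_min e10.
  by rewrite le_min => /and3P[k0 k1 k2]; split;
    [apply: h1 | apply: h2]; rewrite k0.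
have [/= feas /(_ (y + k *: d, z + k *: u))] := hopt.
rewrite /dual_objective /= !dotvDr dotvZr.
have F : dual_feasible A c (y + k *: d, z + k *: u).
  by rewrite /dual_feasible /= mulmxDr -scalemxAr -uE opprD addrACA subrr addr0.
move=> /(_ F).
rewrite (norm1_projE (w := hadamard l z) Tr theta0); last first.
  by move=> i; rewrite mxE; apply: threshold_positive_parts.
rewrite (norm1_projE Tr theta0); last first.
  by move=> i; rewrite !mxE; apply: (hk i).1.
under eq_bigr do rewrite mxE.
under [in X in _ <= X -> _]eq_bigr do rewrite !mxE.
set S := \sum_(i in T) _; set S' := \sum_(i in T) _ => le_obj.
have : S' - S <= k * segment_support (fun i => col i A) lo up d.
  rewrite -sumrB mulr_sumr big_mkcond; apply: ler_sum => i _.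
  rewrite au /lo /up; case: ifP => _; first exact: (hk i).2.
  by rewrite /lower_slope /upper_slope !mul0r maxxx mulr0.
by move=> h; rewrite -(ler_pM2l k0); lra.
Qed.

(** Substituting [c = A^T y - z] turns minimizing [dotv c] into maximizing [dotv z]. *)
Lemma primal_value x : A *m x = b -> dotv c x = dotv b y - dotv z x.
Proof.
have [/= <- _] := hopt => <-.
by rewrite dotvBl dotv_trmx.
Qed.

(** Weak duality: each product is at most [v i], and the support of [x] has at most [#|T|]
    elements. *)
Lemma dotv_primal_le x : primal_feasible A b l r x ->
  dotv z x <= \sum_(i in T) v i.
Proof.
move=> [_ x0 xl]; rewrite norm0E -Tr => xr.
apply: le_trans (threshold_sum_le threshold_positive_parts theta0 xr).
rewrite dotvE [leRHS]big_mkcond; apply: ler_sum => i _.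
case: ifPn => [_|/supportPn ->]; last by rewrite mulr0.
have := x0 i; have := xl i; rewrite mxE /v => xl' x0'.
rewrite le_max; case: (leP 0 (z i 0)) => zi.
  by rewrite mulrC ler_wpM2r.
by rewrite (mulr_le0_ge0 (ltW zi) x0') orbT.
Qed.

(** The clause on negative [z i 0] serves part (i), where it forces the optimal point to be 0. *)
Lemma primal_certificate : exists x, [/\ primal_optimal A b c l r x,
  forall i, i \notin T -> x i 0 = 0 & forall i, z i 0 < 0 -> x i 0 = 0].
Proof.
have lo_up i : lo i <= up i.
  rewrite /lo /up /lower_slope /upper_slope.
  by case: (i \in T) => //=; case: ltgtP => // _; apply: ltW.
have [x hx Ex] := segment_sumP lo_up dual_directional_bound.
have x0 i : 0 <= x i.
  have /andP[+ _] := hx i; apply: le_trans.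
  by rewrite /lo /lower_slope; case: ifP => // _; apply: ltW.
have xl i : x i <= l i 0.
  have /andP[_ h] := hx i; apply: le_trans h _.
  by rewrite /up /upper_slope; case: ifP => // _; apply: ltW.
have xup i : up i = 0 -> x i = 0.
  by have /andP[_ + E] := hx i; rewrite E => h; apply/le_anti; rewrite h x0.
have xT i : i \notin T -> x i = 0.
  by move=> /negPf iT; apply: xup; rewrite /up /upper_slope iT.
(* Complementary slackness: on [T], either [z i 0 = 0] or [lo i = up i] determines [x i]. *)
have zx : dotv z (\col_i x i) = \sum_(i in T) v i.
  rewrite dotvE [RHS]big_mkcond; apply: eq_bigr => i _; rewrite mxE.
  case: ifPn => [iT|/xT ->]; last by rewrite mulr0.
  have := hx i; rewrite /lo /up /lower_slope /upper_slope iT /v /=.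
  case: ltgtP => [zi|zi|<-] h; last by rewrite mul0r mulr0 maxxx.
    by rewrite -(le_anti h) mulrC (max_idPl _)// mulr_ge0 ?ltW.
  by rewrite -(le_anti h) mulr0 (max_idPr _)// mulr_ge0_le0 ?ltW.
have Ab : A *m \col_i x i = b.
  rewrite Ex; apply/colP => i; rewrite mxE summxE; apply: eq_bigr => j _.
  by rewrite !mxE mulrC.
exists (\col_i x i); split => [|i iT|i zi]; last 2 first.
- by rewrite mxE xT.
- by rewrite mxE xup// /up /upper_slope leNgt zi andbF.
split => [|x' x'F].
  split => [//|i|i|]; rewrite ?mxE//.
  by rewrite -Tr norm0_le_card// => i iT; rewrite mxE xT.
have [Ab' _ _ _] := x'F.
by rewrite !primal_value// zx lerD2l lerN2 dotv_primal_le.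
Qed.

End Certificate.

(** * Membership in the leading indices through ranks *)

Section FirstIndices.
Context {n : nat}.
Implicit Types (t : {perm 'I_n}) (k : nat).

Lemma in_first_indices t k i :
  (i \in first_indices t k) = ((t^-1)%g i < k)%N.
Proof.
by rewrite /first_indices -{1}(permKV t i) mem_imset ?inE//; apply: perm_inj.
Qed.

Lemma card_first_indices t k : (k <= n)%N -> #|first_indices t k| = k.
Proof.
move=> kn; rewrite /first_indices card_imset; last exact: perm_inj.
by rewrite -sum1dep_card (big_ord_narrow kn) sum_nat_const card_ord muln1.
Qed.

End FirstIndices.

(** * Choice of the threshold under each condition *)

Theorem theorem5p2 (R : realType) (m n : nat) (A : 'M[R]_(m, n))
    (b : 'cV[R]_m) (c l : 'cV[R]_n) (r : nat)
    (hl : vlt 0 l) (hr0 : (0 < r)%N) (hrn : (r <= n)%N)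
    (hfeas : exists x, primal_feasible A b l r x)
    (ystar : 'cV[R]_m) (zstar : 'cV[R]_n)
    (hopt : dual_optimal A b c l r (ystar, zstar))
    (t : {perm 'I_n})
    (ht : forall i j : 'I_n, (i <= j)%N ->
            l (t j) 0 * zstar (t j) 0 <= l (t i) 0 * zstar (t i) 0) :
  (vlt zstar 0 -> primal_optimal A b c l r 0) /\
  ([\/ norm0 (pospart zstar) = r,
       (norm0 (pospart zstar) > r)%N /\
       (exists i j : 'I_n, [/\ i.+1 = r, j = r :> nat &
          l (t i) 0 * zstar (t i) 0 > l (t j) 0 * zstar (t j) 0])
     | (0 < norm0 (pospart zstar) < r)%N /\
       (exists j : 'I_n, j = r :> nat /\ zstar (t j) 0 < 0)] ->
   optimal_index_set A b c l r (first_indices t r)).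
Proof.
have l0 i : 0 < l i 0 by have := hl i; rewrite mxE.
pose w i := l i 0 * zstar i 0.
have w_gt0 i : (0 < w i) = (0 < zstar i 0) by rewrite pmulr_rgt0.
have w_lt0 i : (w i < 0) = (zstar i 0 < 0) by rewrite pmulr_rlt0.
have sorted i j : ((t^-1)%g i <= (t^-1)%g j)%N -> w j <= w i.
  by move=> /ht; rewrite !permKV.
have Fr := card_first_indices t hrn.
have cert := primal_certificate hl hopt Fr.
(* In part (i) the threshold is 0, since all entries of [w] are negative. *)
split=> [z0|cond].
  have [|i|x [xopt _ x0]] := cert 0; first exact: lexx.
    by case: ifP => _; [left | right; rewrite -/(w i) w_lt0; have := z0 i; rewrite mxE].
  suff <- : x = 0 by [].
  by apply/colP => i; rewrite x0 ?mxE//; have := z0 i; rewrite mxE.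
suff [theta theta0 /(cert _ theta0)[x [xopt xF _]]] : exists2 theta, 0 <= theta &
    forall i, if i \in first_indices t r then theta = 0 \/ theta < w i
      else w i < theta \/ theta = 0 /\ w i < 0.
  by split=> //; exists x; split=> //; apply: in_coord_space.
(* Positions start at 0: [r.-1] holds the smallest selected entry and [r] the largest rejected
   one. *)
have lastF i (j : 'I_n) : j = r.-1 :> nat -> i \in first_indices t r -> w (t j) <= w i.
  move=> jr; rewrite in_first_indices => ir; apply: sorted.
  by rewrite permK jr -ltnS prednK.
have firstC i (j : 'I_n) : j = r :> nat -> i \notin first_indices t r -> w i <= w (t j).
  by move=> jr; rewrite in_first_indices -leqNgt => ir; apply: sorted; rewrite permK jr.
case: cond => [norm0_r|[_ [i [j [ir jr wji]]]]|[_ [j [jr zj]]]].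
- pose P := [set i | 0 < zstar i 0].
  have Pr : #|P| = r.
    rewrite -norm0_r norm0E; apply: eq_card => i; rewrite !inE !mxE.
    by case: ltP => [/gt_eqF ->|_]; rewrite ?eqxx.
  have FP : first_indices t r \subset P.
    apply/fintype.subsetP => i; rewrite in_first_indices; apply: contraLR => iP.
    (* All positive entries precede the nonpositive [w i], so the rank of [i] is at least
       [#|P| = r]. *)
    rewrite -leqNgt -Pr -[X in (_ <= X)%N](@card_first_indices n t); last exact: ltnW.
    apply/subset_leq_card/fintype.subsetP => j; rewrite in_first_indices.
    rewrite inE -w_gt0; apply: contraLR; rewrite -leqNgt => /sorted wji.
    by move: iP; rewrite inE -w_gt0 -!leNgt; apply: le_trans.
  have EF : first_indices t r = P by apply/eqP; rewrite eqEcard FP Pr Fr leqnn.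
  have hr : (r.-1 < n)%N by rewrite prednK.
  have /= := lastF _ (Ordinal hr) erefl; set wr := w _ => wrF.
  have wr0 : 0 < wr.
    have : t (Ordinal hr) \in P by rewrite -EF in_first_indices permK /= prednK.
    by rewrite inE -w_gt0.
  (* Half of the smallest positive entry: the entries off [P] are nonpositive. *)
  exists (wr / 2); first lra.
  move=> i; case: ifP => [/wrF|]; first by lra.
  by rewrite EF inE -w_gt0 ltNge => /negbFE; lra.
- have hi k : k \in first_indices t r -> w (t i) <= w k.
    by apply: lastF; rewrite -ir.
  have hj k := firstC k j jr.
  rewrite -/(w (t i)) -/(w (t j)) in wji.
  (* The midpoint of the gap separates; if it is not positive, 0 serves, since the rejected entries
     lie strictly below the midpoint. *)
  have [mid|mid] := leP ((w (t i) + w (t j)) / 2) 0.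
    by exists 0 => // k; case: ifPn => [_|/hj]; [left | right; split=> //; lra].
  exists ((w (t i) + w (t j)) / 2); first exact: ltW.
  by move=> k; case: ifPn => [/hi|/hj]; lra.
(* In case (c) the largest rejected entry is already negative. *)
- exists 0 => // i; case: ifPn => [_|/(firstC _ _ jr)]; [by left | right].
  by split=> //; move: zj; rewrite -w_lt0; apply: le_lt_trans.
Qed.
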